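(* Let $\mathcal{T}$ be a positive linear form on $\mathcal{L}_{n,m}$ satisfying the matrix condition $AT^jB=0$ for $j=0,1,\dots,n-1$. Call a pair $(\mathcal{K}_1,\mathcal{K}_2)$ of subspaces of $\mathcal{H}_{\mathcal T}$ a pair satisfying the split-shift condition if (1) $\mathcal{E}^1_{n-1,m}=\mathcal{K}_1\oplus\mathcal{K}_2$, (2) $\mathcal{K}_1\perp z\mathcal{K}_2$, (3) $\mathcal{K}_1,\ z\mathcal{K}_2\subset\mathcal{E}^1_{n,m}$. Then: (a) $(\mathcal{K}_1,\mathcal{K}_2)=(\mathcal{E}^1_{n-1,m}\ominus\mathcal{B},\ \mathcal{B})$ satisfies the split-shift condition, where $\mathcal{B}=\mathrm{span}\{T^jBf: f\in w\mathcal{F}^2_{n,m-1},\ j=0,1,\dots\}$. (b) $(\mathcal{K}_1,\mathcal{K}_2)=(\mathcal{A},\ \mathcal{E}^1_{n-1,m}\ominus\mathcal{A})$ satisfies the split-shift condition, where $\mathcal{A}=\mathrm{span}\{(T^* )^jA^*f: f\in w\mathcal{E}^2_{n,m-1},\ j=0,1,\dots\}$. (c) If $(\mathcal{K}_1',\mathcal{K}_2')$ is any other pair satisfying the split-shift condition, then $\mathcal{A}\subset\mathcal{K}_1'$ and $\mathcal{B}\subset\mathcal{K}_2'$.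
   Context: $n,m$ are nonnegative integers. $\mathcal{L}_{j,k}$ is the complex span of $z^sw^t$, $-j\le s\le j$, $-k\le t\le k$, and $\mathcal{P}_{j,k}$ the complex span of $z^sw^t$, $0\le s\le j$, $0\le t\le k$ (with $\mathcal{P}_{j,k}=\{0\}$ if $j<0$ or $k<0$). For a polynomial $g$, $\bar g(z,w)=\overline{g(\bar z,\bar w)}$. A linear form $\mathcal{T}:\mathcal{L}_{n,m}\to\mathbb{C}$ is positive if $\mathcal{T}(f(z,w)\bar f(1/z,1/w))>0$ for all nonzero $f\in\mathcal{P}_{n,m}$. $\mathcal{H}_{\mathcal T}$ is $\mathcal{P}_{n,m}$ with inner product $\langle f,g\rangle_{\mathcal T}=\mathcal{T}(f(z,w)\bar g(1/z,1/w))$; all orthogonality, orthogonal direct sums, complements and orthogonal projections $P_{\mathcal M}$ are in $\mathcal{H}_{\mathcal T}$. Put $\mathcal{E}^1_{k,l}=\mathcal{P}_{k,l}\ominus w\mathcal{P}_{k,l-1}$, $\mathcal{E}^2_{k,l}=\mathcal{P}_{k,l}\ominus z\mathcal{P}_{k-1,l}$, $\mathcal{F}^2_{k,l}=\mathcal{P}_{k,l}\ominus\mathcal{P}_{k-1,l}$. Operators ($M_z$ is multiplication by $z$): $A=P_{w\mathcal{E}^2_{n,m-1}}M_z:\mathcal{E}^1_{n-1,m}\to w\mathcal{E}^2_{n,m-1}$; $B=P_{\mathcal{E}^1_{n-1,m}}:w\mathcal{F}^2_{n,m-1}\to\mathcal{E}^1_{n-1,m}$; $T=P_{\mathcal{E}^1_{n-1,m}}M_z:\mathcal{E}^1_{n-1,m}\to\mathcal{E}^1_{n-1,m}$.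 $A^*$ and $T^*$ are the Hilbert space adjoints. *)

(* Defs.v *)
From mathcomp Require Import all_boot all_order all_algebra.
From mathcomp Require Import boolp classical_sets reals.
From mathcomp Require Import complex mpoly.

Set Implicit Arguments.
Unset Strict Implicit.
Unset Printing Implicit Defensive.

Import Order.TTheory GRing.Theory Num.Theory.

Local Open Scope classical_set_scope.
Local Open Scope ring_scope.

Local Notation poly2 R := {mpoly R[i][2]}.
(* Laurent polynomials live in the field C(z, w). *)
Local Notation ratfun R := {fraction {mpoly R[i][2]}}.

Section LinearSpan.
Variables (K : pzRingType) (V : lmodType K).

Definition is_subspace (M : set V) : Prop :=
  M 0 /\ forall (a : K) (f g : V), M f -> M g -> M (a *: f + g).

Definition span (S : set V) : set V := smallest is_subspace S.

End LinearSpan.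

Section Polynomials.
Variable R : realType.

Definition z : poly2 R := 'X_0.
Definition w : poly2 R := 'X_1.

Definition scal (c : R[i]) : ratfun R := tofrac c%:MP.

(* The indices are integers, so that j = -1 or k = -1 gives span set0 = {0}. *)
Definition P_ (j k : int) : set (poly2 R) :=
  span [set p | exists s t : nat,
          [/\ s%:Z <= j, t%:Z <= k & p = z ^+ s * w ^+ t]].

Definition L_ (j k : nat) : set (ratfun R) :=
  [set h | exists c : int -> int -> R[i],
     h = \sum_(s < j.*2.+1) \sum_(t < k.*2.+1)
           scal (c (s%:Z - j%:Z) (t%:Z - k%:Z))
             * tofrac z ^ (s%:Z - j%:Z) * tofrac w ^ (t%:Z - k%:Z)].

(* conj (g (conj z, conj w)), i.e. g with conjugated coefficients *)
Definition polybar (g : poly2 R) : poly2 R := map_mpoly Num.conj g.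

(* g (1/z, 1/w) *)
Definition eval_inv (g : poly2 R) : ratfun R :=
  mmap scal (fun i : 'I_2 => (tofrac 'X_i)^-1) g.

(* f (z, w) * gbar (1/z, 1/w) *)
Definition star_mul (f g : poly2 R) : ratfun R :=
  tofrac f * eval_inv (polybar g).

(* A linear form on L_{n,m} is a function on C(z, w) of which only the values
   on L_{n,m} matter. *)
Definition linear_form (n m : nat) (tau : ratfun R -> R[i]) : Prop :=
  forall (a : R[i]) (g h : ratfun R), L_ n m g -> L_ n m h ->
    tau (scal a * g + h) = a * tau g + tau h.

(* In R[i], 0 < x means that x is real and positive. *)
Definition positive_form (n m : nat) (tau : ratfun R -> R[i]) : Prop :=
  forall f : poly2 R, P_ n m f -> f != 0 -> 0 < tau (star_mul f f).

Definition times (p : poly2 R) (M : set (poly2 R)) : set (poly2 R) :=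
  [set p * f | f in M].

End Polynomials.

Arguments z {R}.
Arguments w {R}.

Section InnerProduct.
Variables (R : realType) (tau : ratfun R -> R[i]).
Implicit Types M N : set (poly2 R).

Definition inner (f g : poly2 R) : R[i] := tau (star_mul f g).

Definition perp M N : Prop := forall f g, M f -> N g -> inner f g = 0.

Definition ominus M N : set (poly2 R) :=
  [set f | M f /\ forall g, N g -> inner f g = 0].

(* E is the orthogonal direct sum of M and N. *)
Definition orth_sum E M N : Prop :=
  perp M N /\ E = [set f | exists g h, [/\ M g, N h & f = g + h]].

(* The point g of M with f - g orthogonal to M; when tau is positive it exists
   and is unique for every subspace M of P_{n,m} and every f in P_{n,m}. *)
Definition proj M (f : poly2 R) : poly2 R :=
  xget 0 [set g | M g /\ forall h, M h -> inner (f - g) h = 0].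

(* Hilbert space adjoint of an operator S with domain D; when tau is positive,
   D is a subspace of P_{n,m} and S is linear from D to P_{n,m}, the value at
   each g in P_{n,m} exists and is unique. *)
Definition adjoint (D : set (poly2 R)) (S : poly2 R -> poly2 R) (g : poly2 R) :
    poly2 R :=
  xget 0 [set h | D h /\ forall f, D f -> inner (S f) g = inner f h].

Definition E1 (k l : int) : set (poly2 R) :=
  ominus (P_ k l) (times w (P_ k (l - 1))).
Definition E2 (k l : int) : set (poly2 R) :=
  ominus (P_ k l) (times z (P_ (k - 1) l)).
Definition F2 (k l : int) : set (poly2 R) :=
  ominus (P_ k l) (P_ (k - 1) l).

End InnerProduct.

Section Operators.
Variables (R : realType) (n m : nat) (tau : ratfun R -> R[i]).

Definition domE1 : set (poly2 R) := E1 tau (n%:Z - 1) m.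
Definition wE2 : set (poly2 R) := times w (E2 tau n (m%:Z - 1)).
Definition wF2 : set (poly2 R) := times w (F2 tau n (m%:Z - 1)).

(* The operators below are meant on the domains domE1, wF2 and domE1. *)
Definition opA (f : poly2 R) : poly2 R := proj tau wE2 (z * f).
Definition opB (f : poly2 R) : poly2 R := proj tau domE1 f.
Definition opT (f : poly2 R) : poly2 R := proj tau domE1 (z * f).

(* adjoints of opA and opT, on the domains wE2 and domE1 *)
Definition adjA : poly2 R -> poly2 R := adjoint tau domE1 opA.
Definition adjT : poly2 R -> poly2 R := adjoint tau domE1 opT.

Definition matrix_condition : Prop :=
  forall j : nat, (j < n)%N -> forall f, wF2 f -> opA (iter j opT (opB f)) = 0.

Definition split_shift (K1 K2 : set (poly2 R)) : Prop :=
  [/\ orth_sum tau domE1 K1 K2,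
      perp tau K1 (times z K2),
      K1 `<=` E1 tau n m
    & times z K2 `<=` E1 tau n m].

(* Subspaces of H_tau satisfying the split-shift condition *)
Definition split_shift_pair (K1 K2 : set (poly2 R)) : Prop :=
  [/\ is_subspace K1 /\ K1 `<=` P_ n m,
      is_subspace K2 /\ K2 `<=` P_ n m
    & split_shift K1 K2].

Definition spaceB : set (poly2 R) :=
  span [set g | exists f (j : nat), wF2 f /\ g = iter j opT (opB f)].
Definition spaceA : set (poly2 R) :=
  span [set g | exists f (j : nat), wE2 f /\ g = iter j adjT (adjA f)].

End Operators.

(* Main.v *)
Require Import Defs.
From mathcomp Require Import all_boot all_order all_algebra.
From mathcomp Require Import boolp classical_sets reals.
From mathcomp Require Import complex mpoly ring zify.

(** Write H for P_{n,m} with the inner product of tau and D for E^1_{n-1,m}.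

    For a subspace K2 of D with orthogonal complement K1 in D, the split-shift
    condition is a statement about K2 alone, [split_shift_pairP]:
    - K1 is orthogonal to z K2 iff it is orthogonal to T K2, that is, iff K2 is
      T-invariant;
    - K1 lies in E^1_{n,m} iff it is orthogonal to the range of B ([in_E1]),
      that is, iff K2 contains the range of B;
    - z K2 lies in E^1_{n,m} iff A vanishes on K2 ([mulz_in_E1]).
    The last two equivalences hold because a vector of E^1_{n,m} has to be
    orthogonal to w P_{n,m-1}, and P_{n,m-1} splits orthogonally both as
    P_{n-1,m-1} + F^2_{n,m-1} and as z P_{n-1,m-1} + E^2_{n,m-1}; the first
    summand is taken care of by membership in D and, in the second case, by
    multiplication by z being isometric.

    So the admissible K2 are the T-invariant subspaces between the range of B
    and the kernel of A. The smallest T-invariant subspace containing the range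
    of B is the space B of the theorem. The largest one inside the kernel of A
    consists of the f with A T^j f = 0 for all j; as
    <A T^j f, g> = <f, T*^j A* g>, it is the complement of the space A of the
    theorem ([perp_spaceA]). Hence every admissible K2 lies between these two,
    which is (c), and both are admissible, which is (a) and (b), as soon as
    A T^j B = 0 for all j.

    The hypothesis gives this for j < n only. But D is generated by n vectors,
    the projections of 1, z, ..., z^(n-1) ([domE1_generators]), so by
    Cayley-Hamilton T^j is on D a combination of the T^i with i < n
    ([iter_vanish]).

    Projections and adjoints are given by Riesz representation in a
    finite-dimensional inner product space ([riesz]), whose Hermitian symmetry
    comes from positivity ([ip_sym]). *)

Set Implicit Arguments.
Unset Strict Implicit.
Unset Printing Implicit Defensive.

Import Order.TTheory GRing.Theory Num.Theory.

Local Open Scope classical_set_scope.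
Local Open Scope ring_scope.

(** * Subspaces and maps linear on a subspace *)

Section Subspaces.
Variables (K : pzRingType) (V W : lmodType K).
Implicit Types (M D : set V) (phi : V -> W).

Lemma span_subspace (S : set V) : is_subspace (Defs.span S).
Proof.
split=> [M [[]]//|a f g Sf Sg M MS].
by apply: MS.1.2; [exact: Sf|exact: Sg].
Qed.

Lemma mem_span (S : set V) f : S f -> Defs.span S f.
Proof. by move=> Sf M [_]; exact. Qed.

Lemma subspace_sum M I (r : seq I) (c : I -> K) (u : I -> V) :
  is_subspace M -> (forall i, M (u i)) -> M (\sum_(i <- r) c i *: u i).
Proof.
move=> [M0 MD] Mu; elim: r => [|i r IH]; first by rewrite big_nil.
by rewrite big_cons; exact: MD.
Qed.

Lemma combination_subspace d (e : 'I_d -> V) :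
  is_subspace [set f | exists c : 'rV_d, f = \sum_i c 0 i *: e i].
Proof.
split=> [|a _ _ [c1 ->] [c2 ->]].
  by exists 0; rewrite big1// => i _; rewrite mxE scale0r.
exists (a *: c1 + c2); rewrite scaler_sumr -big_split; apply: eq_bigr => i _ /=.
by rewrite !mxE scalerDl scalerA.
Qed.

Lemma subspaceB M f g : is_subspace M -> M f -> M g -> M (f - g).
Proof. by move=> [M0 MD] Mf Mg; rewrite -scaleN1r addrC; exact: MD. Qed.

Lemma subspaceD M f g : is_subspace M -> M f -> M g -> M (f + g).
Proof. by move=> [M0 MD] Mf Mg; rewrite -[f]scale1r; exact: MD. Qed.

(** The operators of interest are total functions that are linear only on the
    subspace where they are meant to act. *)
Definition linear_on D phi : Prop :=
  forall (a : K) (f g : V), D f -> D g -> phi (a *: f + g) = a *: phi f + phi g.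

Lemma linear_on0 D phi : is_subspace D -> linear_on D phi -> phi 0 = 0.
Proof.
move=> [D0 _] /(_ (-1) 0 0 D0 D0).
by rewrite scaler0 addr0 scaleN1r addNr.
Qed.

Lemma linear_on_sum D phi I (r : seq I) (c : I -> K) (u : I -> V) :
  is_subspace D -> linear_on D phi -> (forall i, D (u i)) ->
  phi (\sum_(i <- r) c i *: u i) = \sum_(i <- r) c i *: phi (u i).
Proof.
move=> sD lphi Du; elim: r => [|i r IH].
  by rewrite !big_nil (linear_on0 sD).
by rewrite !big_cons lphi ?IH//; exact: subspace_sum.
Qed.

End Subspaces.

(** * Vanishing along the orbit of a linear operator *)

Section CayleyHamilton.
Variables (K : fieldType) (V W : lmodType K) (D : set V).
Variables (T : V -> V) (A : V -> W).
Hypotheses (sD : is_subspace D) (DT : forall f, D f -> D (T f)).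
Hypotheses (lT : linear_on D T) (lA : linear_on D A).

(** If X is the matrix of T on the generators e, the remainder of 'X^j modulo
    the characteristic polynomial of X has degree less than n, and by
    Cayley-Hamilton it takes the same value as 'X^j at X; so A (T^j f) is a
    combination of the A (T^i f) with i < n. When the e i are dependent, X is
    one of several matrices representing T, and any of them will do. *)
Lemma iter_vanish n (e : 'I_n -> V) f :
    (forall i, D (e i)) ->
    (forall g, D g -> exists c : 'rV_n, g = \sum_i c 0 i *: e i) ->
    D f -> (forall j, (j < n)%N -> A (iter j T f) = 0) ->
  forall j, A (iter j T f) = 0.
Proof.
case: n e => [|n] e De spanD Df vanish j.
  have Dj : D (iter j T f) by elim: j => //= j; exact: DT.
  by have [c ->] := spanD _ Dj; rewrite big_ord0 (linear_on0 sD lA).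
have [X TX] : {X : 'M_n.+1 & forall i, T (e i) = \sum_k X i k *: e k}.
  have /choice [x Tx] i : exists c : 'rV_n.+1, T (e i) = \sum_k c 0 k *: e k.
    exact/spanD/DT.
  exists (\matrix_i x i) => i; rewrite Tx; apply: eq_bigr => k _.
  by rewrite mxE.
have [c fc] := spanD f Df.
have iterX k : iter k T f = \sum_i (c *m X ^+ k) 0 i *: e i.
  elim: k => [|k /= ->]; first by rewrite expr0 mulmx1.
  rewrite (linear_on_sum _ _ sD lT)// exprSr mulmxA.
  transitivity (\sum_i \sum_l (c *m X ^+ k) 0 i *: (X i l *: e l)).
    by apply: eq_bigr => i _; rewrite TX scaler_sumr.
  rewrite exchange_big; apply: eq_bigr => i _.
  rewrite [in RHS]mxE scaler_suml; apply: eq_bigr => l _.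
  by rewrite scalerA.
(* With ev B the value of A at the combination of coefficients c *m B, the
   claim becomes a statement about the linear map ev. *)
pose ev (B : 'M_n.+1) := A (\sum_i (c *m B) 0 i *: e i).
have evX k : ev (X ^+ k) = A (iter k T f) by rewrite iterX.
have evE B : ev B = \sum_i (c *m B) 0 i *: A (e i).
  exact: (linear_on_sum _ _ sD lA).
have lev a B B' : ev (a *: B + B') = a *: ev B + ev B'.
  rewrite !evE scaler_sumr -big_split; apply: eq_bigr => i _ /=.
  by rewrite scalerA -scalerDl mulmxDr -scalemxAr !mxE.
rewrite -evX; pose r := 'X^j %% char_poly X.
have -> : X ^+ j = \sum_(i < size r) r`_i *: X ^+ i.
  rewrite -[in LHS](horner_mx_X X) -rmorphXn/=.
  rewrite (divp_eq 'X^j (char_poly X)) rmorphD rmorphM/= Cayley_Hamilton.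
  rewrite mulr0 add0r -/r -[in LHS](coefK r) poly_def rmorph_sum/=.
  by apply: eq_bigr => i _; rewrite horner_mxZ rmorphXn/= horner_mx_X.
have szr : (size r <= n.+1)%N.
  by rewrite -ltnS -(size_char_poly X) ltn_modp -size_poly_eq0 size_char_poly.
have lev' : linear_on setT ev by move=> a B B' _ _; exact: lev.
rewrite (linear_on_sum _ _ _ lev')//.
rewrite big1// => i _; rewrite evX vanish ?scaler0//.
exact: leq_trans (ltn_ord i) szr.
Qed.

End CayleyHamilton.

(** * Finite-dimensional inner product spaces *)

Section InnerProductSpace.
Variables (C : numClosedFieldType) (V : lmodType C).
Variables (H : set V) (ip : V -> V -> C).

(** Over the complex numbers, Hermitian symmetry follows from these axioms: see
    [ip_sym]. *)
Definition inner_product : Prop :=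
  [/\ forall a f g h, H f -> H g -> H h ->
        ip (a *: f + g) h = a * ip f h + ip g h,
      forall a f g h, H f -> H g -> H h ->
        ip h (a *: f + g) = a^* * ip h f + ip h g
    & forall f, H f -> f != 0 -> 0 < ip f f].

Hypotheses (sH : is_subspace H) (ipH : inner_product).

Let ipl : forall a f g h, H f -> H g -> H h ->
  ip (a *: f + g) h = a * ip f h + ip g h.
Proof. by case: ipH. Qed.

Let ipr : forall a f g h, H f -> H g -> H h ->
  ip h (a *: f + g) = a^* * ip h f + ip h g.
Proof. by case: ipH. Qed.

Let ip_gt0 : forall f, H f -> f != 0 -> 0 < ip f f.
Proof. by case: ipH. Qed.

Lemma ip_linear_on h : H h -> linear_on H (ip^~ h : V -> C^o).
Proof. by move=> Hh a f g Hf Hg; exact: ipl. Qed.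

Lemma ip0l h : H h -> ip 0 h = 0.
Proof. by move=> Hh; rewrite (linear_on0 sH (ip_linear_on Hh)). Qed.

Lemma ip_eq0 f : H f -> ip f f = 0 -> f = 0.
Proof.
move=> Hf ff0; have [//|/(ip_gt0 Hf)] := eqVneq f 0.
by rewrite ff0 ltxx.
Qed.

Lemma ip_real f : H f -> (ip f f)^* = ip f f.
Proof.
move=> Hf; have [f0|nz] := eqVneq f 0; first by rewrite f0 (ip0l sH.1) conjC0.
exact: geC0_conj (ltW (ip_gt0 Hf nz)).
Qed.

(** Polarization: the values <a f + g, a f + g> are real, and a = 1 and a = 'i
    determine the real and the imaginary part of the symmetry. *)
Lemma ip_sym f g : H f -> H g -> ip g f = (ip f g)^*.
Proof.
move=> Hf Hg.
have polar a : (a * ip f g + a^* * ip g f)^* = a * ip f g + a^* * ip g f.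
  have Ha : H (a *: f + g) by exact: sH.2.
  have := ip_real Ha; rewrite ipl// !ipr// mulrDr !rmorphD !rmorphM/= !conjCK.
  rewrite !ip_real//; rewrite [a^* * (a * _)]mulrCA => E.
  apply: (addrI (a * (a^* * ip f f))); apply: (addIr (ip g g)).
  by rewrite !addrA in E *.
have := polar 1; have := polar 'i.
rewrite !rmorphD !rmorphM/= !conjCK rmorph1 conjCi !mul1r.
set x := ip f g; set y := ip g f => pi p1.
have {}pi : y^* - x^* = x - y.
  apply: (mulfI (neq0Ci C)); rewrite !mulrBr -!mulNr -pi addrC.
  by rewrite mulNr.
have yx : y^* *+ 2 = x *+ 2.
  have -> : y^* *+ 2 = (x^* + y^*) + (y^* - x^*) by ring.
  by rewrite p1 pi; ring.
rewrite -[y]conjCK; congr (_^*).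
by apply: (mulIf (x := 2%:R)); rewrite ?pnatr_eq0 ?mulr_natr.
Qed.

Lemma ip_suml I (r : seq I) (c : I -> C) (u : I -> V) h :
  (forall i, H (u i)) -> H h ->
  ip (\sum_(i <- r) c i *: u i) h = \sum_(i <- r) c i * ip (u i) h.
Proof. by move=> Hu Hh; exact: (linear_on_sum _ _ sH (ip_linear_on Hh)). Qed.

Definition orthogonal_family (M : set V) k (u : 'I_k -> V) : Prop :=
  [/\ forall i, M (u i), forall i, u i != 0
    & forall i j, i != j -> ip (u i) (u j) = 0].

(** Nonzero orthogonal vectors are linearly independent, whereas more than d
    combinations of d vectors admit a nontrivial relation, given by the kernel
    of the matrix of their coefficients. *)
Lemma orthogonal_family_size d (e : 'I_d -> V) k (u : 'I_k -> V) :
    (forall f, H f -> exists c : 'rV_d, f = \sum_i c 0 i *: e i) ->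
  orthogonal_family H u -> (k <= d)%N.
Proof.
move=> spanH [Hu u0 uo]; rewrite leqNgt; apply/negP => ltdk.
have /choice [x ux] i : exists c : 'rV_d, u i = \sum_j c 0 j *: e j.
  exact: spanH.
pose X := \matrix_i x i.
have : kermx X != 0.
  rewrite kermx_eq0 /row_free; apply: contraTneq ltdk => <-.
  by rewrite -leqNgt rank_leq_col.
case/rowV0Pn => c /sub_kermxP cX /eqP[]; apply/rowP => j.
have sum0 : \sum_i c 0 i *: u i = 0.
  transitivity (\sum_i \sum_l (c 0 i * X i l) *: e l).
    apply: eq_bigr => i _; rewrite ux scaler_sumr.
    by apply: eq_bigr => l _; rewrite scalerA mxE.
  rewrite exchange_big big1// => l _; rewrite -scaler_suml.
  have /rowP/(_ l) := cX; rewrite !mxE => ->.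
  by rewrite scale0r.
have := ip_suml (index_enum _) (c 0) Hu (Hu j).
rewrite sum0 ip0l// (bigD1 j)//= big1 ?addr0; last first.
  by move=> i ij; rewrite uo// mulr0.
move/esym/eqP; rewrite mulf_eq0 => /orP[/eqP ->|]; first by rewrite mxE.
by rewrite gt_eqF// ip_gt0.
Qed.

Lemma orthogonal_family_extend M k (u : 'I_k -> V) g :
    M `<=` H -> orthogonal_family M u -> M g -> g != 0 ->
    (forall i, ip g (u i) = 0) ->
  exists u' : 'I_k.+1 -> V, orthogonal_family M u'.
Proof.
move=> MH [Mu u0 uo] Mg g0 go.
exists (fun i => oapp u g (unlift ord0 i)); split=> [i|i|i j].
- by case: (unliftP ord0 i) => [i' _|_] /=; [exact: Mu|exact: Mg].
- by case: (unliftP ord0 i) => [i' _|_] /=; [exact: u0|exact: g0].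
case: (unliftP ord0 i) => [i' ->|->]; case: (unliftP ord0 j) => [j' ->|->] //=.
- by rewrite (inj_eq (lift_inj)); exact: uo.
- by rewrite ip_sym ?go ?conjC0; auto.
Qed.

(** An orthogonal family of M of maximal size spans M: otherwise the component
    of some f orthogonal to the family would extend it. *)
Lemma orthogonal_basis d (e : 'I_d -> V) M :
    (forall f, H f -> exists c : 'rV_d, f = \sum_i c 0 i *: e i) ->
    is_subspace M -> M `<=` H ->
  exists k (u : 'I_k -> V), orthogonal_family M u /\
    forall f, M f -> f = \sum_i (ip f (u i) / ip (u i) (u i)) *: u i.
Proof.
move=> spanH sM MH.
pose P k := `[< exists u : 'I_k -> V, orthogonal_family M u >].
have P0 : exists k, P k.
  by exists 0%N; apply/asboolP; exists (fun=> 0); split=> -[].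
have Pd k : P k -> (k <= d)%N.
  move=> /asboolP[u [Mu u0 uo]]; apply: (orthogonal_family_size (u := u) spanH).
  by split=> // i; exact: MH.
case: (ex_maxnP P0 Pd) => k /asboolP[u Ou] kmax.
exists k, u; split=> // f Mf; apply/eqP; rewrite -subr_eq0; apply/negP => nz.
case: (Ou) => Mu u0 uo; have Hu i := MH _ (Mu i).
set g := f - _ in nz.
have Mg : M g by apply: subspaceB => //; exact: subspace_sum.
suff /(orthogonal_family_extend MH Ou Mg (introN idP nz)) [u' Ou'] :
    forall i, ip g (u i) = 0.
  by have /kmax := asboolT (ex_intro _ u' Ou'); rewrite ltnn.
move=> i; rewrite /g addrC -scaleN1r ipl;
  [|by apply: subspace_sum; auto|auto|auto].
rewrite ip_suml// (bigD1 i)//= big1 ?addr0; last first.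
  by move=> j ij; rewrite [ip (u j) (u i)]uo ?mulr0.
by rewrite divfK ?mulN1r ?addNr// gt_eqF// ip_gt0.
Qed.

(** The representing vector has the Fourier coefficients forced by the values
    of phi on an orthogonal basis of M. *)
Lemma riesz d (e : 'I_d -> V) M (phi : V -> C^o) :
    (forall f, H f -> exists c : 'rV_d, f = \sum_i c 0 i *: e i) ->
    is_subspace M -> M `<=` H -> linear_on M phi ->
  exists2 g, M g & forall f, M f -> phi f = ip f g.
Proof.
move=> spanH sM MH lphi.
have [k [u [[Mu u0 uo] uf]]] := orthogonal_basis spanH sM MH.
have Hu i := MH _ (Mu i).
pose g := \sum_i (phi (u i) / ip (u i) (u i))^* *: u i.
have Mg : M g by exact: subspace_sum.
exists g => // f Mf; have Hf := MH _ Mf.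
rewrite [in LHS](uf f)// (linear_on_sum _ _ sM lphi)//.
rewrite [RHS]ip_sym ?ip_suml//; last exact: MH.
rewrite rmorph_sum/=; apply: eq_bigr => i _.
rewrite rmorphM/= conjCK -(ip_sym (Hu i) Hf).
by rewrite [_ *: _]mulrAC -mulrA mulrC.
Qed.

Lemma ipB f g h : H f -> H g -> H h -> ip (f - g) h = ip f h - ip g h.
Proof. by move=> Hf Hg Hh; rewrite addrC -scaleN1r ipl// mulN1r addrC. Qed.

Lemma ip_inj M f g : is_subspace M -> M `<=` H -> M f -> M g ->
  (forall h, M h -> ip f h = ip g h) -> f = g.
Proof.
move=> sM MH Mf Mg fg; have Mfg := subspaceB sM Mf Mg.
apply/subr0_eq/ip_eq0; first exact: MH.
by rewrite ipB ?fg ?subrr//; exact: MH.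
Qed.

(** With this subspace, orthogonality to a span reduces to its generators. *)
Lemma ip_annihilator g : H g -> is_subspace [set f | H f /\ ip f g = 0].
Proof.
move=> Hg; split=> [|a f1 f2 [Hf1 f1g] [Hf2 f2g]].
  by split; [exact: sH.1|rewrite ip0l].
by split; [exact: sH.2|rewrite ipl// f1g f2g mulr0 addr0].
Qed.

End InnerProductSpace.

(** * Bivariate polynomials and Laurent polynomials *)

Section Laurent.
Variable R : realType.
Implicit Types (f g h : {mpoly R[i][2]}) (j k : int).

Local Notation poly2 := {mpoly R[i][2]}.

Lemma P_subspace j k : is_subspace (@P_ R j k).
Proof. exact: span_subspace. Qed.

Lemma P_sub j k (M : set poly2) : is_subspace M ->
    (forall s t : nat, s%:Z <= j -> t%:Z <= k -> M (z ^+ s * w ^+ t)) ->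
  P_ j k `<=` M.
Proof.
by move=> sM Mst; apply: smallest_sub => // _ [s [t [sj tk ->]]]; exact: Mst.
Qed.

Lemma mem_P j k (s t : nat) : s%:Z <= j -> t%:Z <= k ->
  @P_ R j k (z ^+ s * w ^+ t).
Proof. by move=> sj tk; apply: mem_span; exists s, t. Qed.

Lemma P_mono j k j' k' : j <= j' -> k <= k' -> @P_ R j k `<=` P_ j' k'.
Proof.
move=> jj' kk'; apply: P_sub => [|s t sj tk]; first exact: P_subspace.
by apply: mem_P; [exact: le_trans jj'|exact: le_trans kk'].
Qed.

Lemma preim_mul_subspace (p : poly2) (M : set poly2) : is_subspace M ->
  is_subspace [set f | M (p * f)].
Proof.
move=> [M0 MD]; split=> [|a f g /= Mf Mg]; first by rewrite /= mulr0.
by rewrite mulrDr -scalerAr; exact: MD.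
Qed.

Lemma times_subspace (p : poly2) (M : set poly2) : is_subspace M ->
  is_subspace (times p M).
Proof.
move=> [M0 MD]; split=> [|a _ _ [f Mf <-] [g Mg <-]].
  by exists 0; rewrite ?mulr0.
by exists (a *: f + g); [exact: MD|rewrite mulrDr scalerAr].
Qed.

Lemma P_mulz j k f : P_ (j - 1) k f -> P_ j k (z * f).
Proof.
apply: (P_sub (M := [set f | P_ j k (z * f)])) => [|s t sj tk].
  by apply: preim_mul_subspace; exact: P_subspace.
by rewrite /= mulrA -exprS; apply: mem_P => //; lia.
Qed.

Lemma P_mulw j k f : P_ j (k - 1) f -> P_ j k (w * f).
Proof.
apply: (P_sub (M := [set f | P_ j k (w * f)])) => [|s t sj tk].
  by apply: preim_mul_subspace; exact: P_subspace.
by rewrite /= mulrCA -exprS; apply: mem_P => //; lia.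
Qed.

Lemma P_finite (n m : nat) : exists d (e : 'I_d -> poly2),
  forall f, P_ n m f -> exists c : 'rV_d, f = \sum_i c 0 i *: e i.
Proof.
pose I := ('I_n.+1 * 'I_m.+1)%type.
pose e (i : 'I_#|{: I}|) : poly2 :=
  z ^+ (enum_val i).1 * w ^+ (enum_val i).2.
exists #|{: I}|, e; apply: P_sub => [|s t sn tm].
  exact: combination_subspace.
have sn' : (s < n.+1)%N by lia.
have tm' : (t < m.+1)%N by lia.
pose i := enum_rank (Ordinal sn', Ordinal tm').
exists (delta_mx 0 i).
rewrite (bigD1 i)//= big1 ?addr0 => [|l li]; last first.
  by rewrite mxE (negPf li) andbF scale0r.
by rewrite mxE !eqxx scale1r /e enum_rankK.
Qed.

(** Modulo w P_{n-1,m-1}, only the n powers of z survive: this bounds the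
    dimension of E^1_{n-1,m} by n. *)
Lemma P_modulo_w (n m : nat) f : P_ (n%:Z - 1) m f ->
  exists (c : 'rV_n) g,
    P_ (n%:Z - 1) (m%:Z - 1) g /\ f = \sum_i c 0 i *: z ^+ i + w * g.
Proof.
move: f; apply: P_sub.
  split=> [|a _ _ [c1 [g1 [Pg1 ->]]] [c2 [g2 [Pg2 ->]]]].
    exists 0, 0; split; first exact: (P_subspace _ _).1.
    by rewrite mulr0 addr0 big1// => i _; rewrite mxE scale0r.
  exists (a *: c1 + c2), (a *: g1 + g2); split; first exact: (P_subspace _ _).2.
  rewrite scalerDr addrACA mulrDr -scalerAr; congr (_ + _).
  rewrite scaler_sumr -big_split; apply: eq_bigr => i _ /=.
  by rewrite !mxE scalerDl scalerA.
move=> s [|t] sn tm.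
  have sn' : (s < n)%N by lia.
  exists (delta_mx 0 (Ordinal sn')), 0; split; first exact: (P_subspace _ _).1.
  rewrite mulr0 addr0 expr0 mulr1 (bigD1 (Ordinal sn'))//= big1 => [|i ni].
    by rewrite mxE !eqxx scale1r addr0.
  by rewrite mxE (negPf ni) andbF scale0r.
exists 0, (z ^+ s * w ^+ t); split; first by apply: mem_P; lia.
rewrite big1 ?add0r => [|i _]; last by rewrite mxE scale0r.
by rewrite exprS mulrCA.
Qed.

Lemma scalD (a b : R[i]) : scal (a + b) = scal a + scal b.
Proof. by rewrite /scal mpolyCD tofracD. Qed.

Lemma scalM (a b : R[i]) : scal (a * b) = scal a * scal b.
Proof. by rewrite /scal mpolyCM tofracM. Qed.

Lemma tofracZ (a : R[i]) f : tofrac (a *: f) = scal a * tofrac f.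
Proof. by rewrite -mul_mpolyC tofracM. Qed.

(** This form exhibits the coefficient map as a ring morphism, so that
    [eval_inv] inherits the algebra of [mmap]. *)
Lemma eval_invE f :
  eval_inv f =
  mmap (@tofrac _ \o @mpolyC 2 _) (fun i : 'I_2 => (tofrac 'X_i)^-1) f.
Proof. by []. Qed.

Lemma eval_invM f g : eval_inv (f * g) = eval_inv f * eval_inv g.
Proof. by rewrite !eval_invE rmorphM. Qed.

Lemma eval_invD f g : eval_inv (f + g) = eval_inv f + eval_inv g.
Proof. by rewrite eval_invE mmapD. Qed.

Lemma eval_invZ a f : eval_inv (a *: f) = scal a * eval_inv f.
Proof. by rewrite eval_invE mmapZ. Qed.

Lemma polybarD f g : polybar (f + g) = polybar f + polybar g.
Proof. by rewrite /polybar rmorphD. Qed.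

Lemma polybarZ a f : polybar (a *: f) = a^* *: polybar f.
Proof. exact: map_mpolyZ. Qed.

Lemma polybarM f g : polybar (f * g) = polybar f * polybar g.
Proof. by rewrite /polybar rmorphM. Qed.

Lemma star_mulDl a f g h :
  star_mul (a *: f + g) h = scal a * star_mul f h + star_mul g h.
Proof. by rewrite /star_mul tofracD tofracZ mulrDl mulrA. Qed.

Lemma star_mulDr a f g h :
  star_mul h (a *: f + g) = scal a^* * star_mul h f + star_mul h g.
Proof.
by rewrite /star_mul polybarD polybarZ eval_invD eval_invZ mulrDr mulrCA.
Qed.

(** The elements x for which the substitution (1/z, 1/w), combined with the
    conjugation of coefficients, is inversion; multiplication by such an x
    preserves f(z,w) gbar(1/z,1/w), hence is isometric. *)
Definition inverted_monomial (x : poly2) : Prop :=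
  tofrac x != 0 /\ eval_inv (polybar x) = (tofrac x)^-1.

Lemma inverted_monomialX (i : 'I_2) : inverted_monomial 'X_i.
Proof.
split; last by rewrite /polybar map_mpolyX eval_invE mmapX mmap1U.
rewrite tofrac_eq0; apply/eqP => /(congr1 (mcoeff U_(i))) /eqP.
by rewrite mcoeffX eqxx mcoeff0 oner_eq0.
Qed.

Lemma inverted_z : inverted_monomial z.
Proof. exact: inverted_monomialX. Qed.

Lemma inverted_w : inverted_monomial w.
Proof. exact: inverted_monomialX. Qed.

Lemma star_mul_shift x f g : inverted_monomial x ->
  star_mul (x * f) (x * g) = star_mul f g.
Proof.
move=> [x0 xV]; rewrite /star_mul polybarM eval_invM.
have cancel (F : fieldType) (a b c d e : F) : a != 0 -> d = a * b -> e = a^-1 ->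
    d * (e * c) = b * c.
  by move=> a0 -> ->; rewrite mulrACA divff// mul1r.
exact: (cancel _ _ _ _ _ _ x0 (tofracM x f) xV).
Qed.

Lemma eval_inv_bar_exp x (k : nat) : inverted_monomial x ->
  eval_inv (polybar (x ^+ k)) = (tofrac x)^-1 ^+ k.
Proof.
move=> [_ xV]; elim: k => [|k IH].
  by rewrite !expr0 /polybar rmorph1 eval_invE rmorph1.
rewrite !exprS polybarM eval_invM.
by congr (_ * _).
Qed.

Lemma star_mul_monomial (s t s' t' : nat) :
  star_mul (z ^+ s * w ^+ t) (z ^+ s' * w ^+ t' : poly2)
  = tofrac z ^ (s%:Z - s'%:Z) * tofrac w ^ (t%:Z - t'%:Z).
Proof.
rewrite /star_mul polybarM eval_invM.
have expand (F : fieldType) (a b p q r : F) : a != 0 -> b != 0 ->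
    p = a ^+ s * b ^+ t -> q = a^-1 ^+ s' -> r = b^-1 ^+ t' ->
    p * (q * r) = a ^ (s%:Z - s'%:Z) * b ^ (t%:Z - t'%:Z).
  move=> a0 b0 -> -> ->; rewrite mulrACA !expfzDr//.
  by rewrite -!invr_expz !exprVn.
apply: (expand _ _ _ _ _ _ inverted_z.1 inverted_w.1).
- by rewrite tofracM !tofracXn.
- exact: eval_inv_bar_exp inverted_z.
- exact: eval_inv_bar_exp inverted_w.
Qed.

Lemma L_closed (n m : nat) (a : R[i]) u v :
  L_ n m u -> L_ n m v -> L_ n m (scal a * u + v).
Proof.
move=> [c ->] [d ->]; exists (fun s t => a * c s t + d s t).
rewrite mulr_sumr -big_split; apply: eq_bigr => s _ /=.
rewrite mulr_sumr -big_split; apply: eq_bigr => t _ /=.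
by rewrite scalD scalM !mulrDl !mulrA.
Qed.

Lemma L_monomial (n m : nat) (s t : int) :
    - n%:Z <= s <= n%:Z -> - m%:Z <= t <= m%:Z ->
  @L_ R n m (tofrac z ^ s * tofrac w ^ t).
Proof.
move=> sn tm; exists (fun p q => ((p == s) && (q == t))%:R).
have scal0 : scal (0 : R[i]) = 0 by rewrite /scal mpolyC0 tofrac0.
have s1 : (`|(s + n)%R| < n.*2.+1)%N by lia.
have t1 : (`|(t + m)%R| < m.*2.+1)%N by lia.
have sE : (`|(s + n)%R|%N%:Z - n%:Z = s) by lia.
have tE : (`|(t + m)%R|%N%:Z - m%:Z = t) by lia.
rewrite (bigD1 (Ordinal s1))//= (bigD1 (Ordinal t1))//= sE tE !eqxx.
rewrite /scal mpolyC1 tofrac1 mul1r !big1 ?addr0// => [i|i].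
  move=> ni; rewrite big1// => k _; rewrite -/(scal _).
  case: eqP => [E|_]; last by rewrite scal0 !mul0r.
  by case/eqP: ni; apply: val_inj => /=; lia.
move=> ni; rewrite andTb -/(scal _).
case: eqP => [E|_]; last by rewrite scal0 !mul0r.
by case/eqP: ni; apply: val_inj => /=; lia.
Qed.

(** Both factors can be taken to be monomials, by sesquilinearity; the
    linearity of tau on L_{n,m} then gives that of the inner product. *)
Lemma star_mul_L (n m : nat) f g :
  P_ n m f -> P_ n m g -> L_ n m (star_mul f g).
Proof.
have L0 : @L_ R n m 0.
  exists (fun _ _ => 0); rewrite big1// => s _; rewrite big1// => t _.
  by rewrite /scal mpolyC0 tofrac0 !mul0r.
move=> Pf; move: f Pf g.
apply: (P_sub (M := [set f | forall g, P_ n m g -> L_ n m (star_mul f g)])).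
  split=> [g _|a f1 f2 L1 L2 g Pg]; first by rewrite /star_mul tofrac0 mul0r.
  by rewrite star_mulDl; apply: L_closed; [exact: L1|exact: L2].
move=> s t sn tm.
apply: (P_sub (M := [set g | L_ n m (star_mul _ g)])).
  split=> [|a g1 g2 /= L1 L2].
    by rewrite /= /star_mul /polybar rmorph0 eval_invE rmorph0 mulr0.
  by rewrite star_mulDr; exact: L_closed.
move=> s' t' sn' tm' /=; rewrite star_mul_monomial.
by apply: L_monomial; lia.
Qed.

End Laurent.

(** * Projections, adjoints and orthogonal complements *)

Section Projections.
Variables (R : realType) (tau : {fraction {mpoly R[i][2]}} -> R[i]).

Local Notation poly2 := {mpoly R[i][2]}.
Local Notation ip := (inner tau).

Variable H : set poly2.
Hypotheses (sH : is_subspace H) (ipP : inner_product H ip).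
Hypothesis (finH : exists d (e : 'I_d -> poly2),
  forall f, H f -> exists c : 'rV_d, f = \sum_i c 0 i *: e i).
Implicit Types (f g h : poly2) (M N K : set poly2).

Local Opaque inner.

Let ip_lin h : H h -> linear_on H (ip^~ h : poly2 -> R[i]^o).
Proof. exact: ip_linear_on ipP _. Qed.

Let ipl a f g h : H f -> H g -> H h ->
  ip (a *: f + g) h = a * ip f h + ip g h.
Proof. by case: ipP => + _ _; apply. Qed.

Lemma ip_sym_eq0 f g : H f -> H g -> ip f g = 0 -> ip g f = 0.
Proof. by move=> Hf Hg fg; rewrite (ip_sym sH ipP Hf Hg) fg conjC0. Qed.

Lemma riesz_in M (phi : poly2 -> R[i]^o) : is_subspace M -> M `<=` H ->
  linear_on M phi -> exists2 g, M g & forall f, M f -> phi f = ip f g.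
Proof.
move=> sM MH lphi; have [d [e spanH]] := finH.
exact: (riesz sH ipP spanH).
Qed.

(** The projection of f represents the functional <-, f> on M. *)
Lemma projP M f : is_subspace M -> M `<=` H -> H f ->
  M (proj tau M f) /\ forall h, M h -> ip (proj tau M f) h = ip f h.
Proof.
move=> sM MH Hf.
have [|g Mg fg] := riesz_in (phi := ip^~ f) sM MH.
  by move=> a h1 h2 /MH Hh1 /MH Hh2; exact: ip_lin.
have [Mp pf] : M (proj tau M f) /\ forall h, M h -> ip (f - proj tau M f) h = 0.
  apply: (xgetPex 0 (P := [set p | M p /\ forall h, M h -> ip (f - p) h = 0])).
  exists g; split=> // h Mh; have [Hg Hh] := (MH _ Mg, MH _ Mh).
  rewrite (ipB ipP)// (ip_sym sH ipP Hh Hf) (ip_sym sH ipP Hh Hg).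
  by rewrite -fg// subrr.
split=> [//|h Mh]; apply/esym/subr0_eq.
by rewrite -(ipB ipP Hf (MH _ Mp) (MH _ Mh)); exact: pf.
Qed.

(** Both sides lie in M and have the same inner products with M. *)
Lemma proj_linear M : is_subspace M -> M `<=` H -> linear_on H (proj tau M).
Proof.
move=> sM MH a f g Hf Hg; have Hag : H (a *: f + g) by exact: sH.2.
have [[Mp pE] [Mf fE] [Mg gE]] :=
  And3 (projP sM MH Hag) (projP sM MH Hf) (projP sM MH Hg).
apply: (ip_inj ipP sM MH) => //; first exact: sM.2.
move=> h Mh; have Hh := MH _ Mh.
rewrite (pE h Mh) (ipl a Hf Hg Hh) (ipl a (MH _ Mf) (MH _ Mg) Hh).
by rewrite (fE h Mh) (gE h Mh).
Qed.

(** The adjoint of S at g represents the functional <S -, g>. *)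
Lemma adjointP M (S : poly2 -> poly2) g : is_subspace M -> M `<=` H ->
    linear_on M S -> (forall f, M f -> H (S f)) -> H g ->
  M (adjoint tau M S g) /\
  forall f, M f -> ip (S f) g = ip f (adjoint tau M S g).
Proof.
move=> sM MH lS HS Hg.
apply: (xgetPex 0 (P := [set h | M h /\ forall f, M f -> ip (S f) g = ip f h])).
have [|h Mh hE] := riesz_in (phi := fun f => ip (S f) g) sM MH;
  last by exists h.
by move=> a f1 f2 Mf1 Mf2; rewrite lS//; apply: ip_lin; auto.
Qed.

Lemma ominus_subspace M N : is_subspace M -> M `<=` H -> N `<=` H ->
  is_subspace (ominus tau M N).
Proof.
move=> sM MH NH; split=> [|a f g [Mf fN] [Mg gN]].
  by split=> [|g /NH Hg]; [exact: sM.1|exact: ip0l sH ipP _ Hg].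
split=> [|h Nh]; first exact: sM.2.
rewrite (ipl a (MH _ Mf) (MH _ Mg) (NH _ Nh)) (fN h Nh) (gN h Nh).
by rewrite mulr0 addr0.
Qed.

Lemma ominus_decomposition M N f : is_subspace M -> M `<=` H ->
    is_subspace N -> N `<=` M -> M f ->
  exists g h, [/\ N g, ominus tau M N h & f = g + h].
Proof.
move=> sM MH sN NM Mf; have NH := subset_trans NM MH.
have [Np pE] := projP sN NH (MH _ Mf).
exists (proj tau N f), (f - proj tau N f); split=> //; last by rewrite subrKC.
split=> [|h Nh]; first by apply: subspaceB => //; exact: NM.
by rewrite (ipB ipP) ?pE ?subrr//; [exact: MH|exact: NH|exact: NH].
Qed.

Lemma perp_sym M N : M `<=` H -> N `<=` H -> perp tau M N -> perp tau N M.
Proof. by move=> MH NH MN f g Nf Mg; apply: ip_sym_eq0; auto. Qed.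

Lemma orth_sum_ominus M N : is_subspace M -> M `<=` H -> is_subspace N ->
  N `<=` M -> orth_sum tau M (ominus tau M N) N.
Proof.
move=> sM MH sN NM; split=> [f g [_]|]; first exact.
apply/seteqP; split=> [f Mf|f [g [h [[Mg _] Nh ->]]]].
  have [g [h [Ng Nh ->]]] := ominus_decomposition sM MH sN NM Mf.
  by exists h, g; rewrite addrC.
by apply: subspaceD => //; exact: NM.
Qed.

Lemma orth_sum_sym M N1 N2 : N1 `<=` H -> N2 `<=` H ->
  orth_sum tau M N1 N2 -> orth_sum tau M N2 N1.
Proof.
move=> N1H N2H [N12 ->]; split; first exact: perp_sym.
by apply/seteqP; split=> f [g [h [? ? ->]]]; exists h, g; rewrite addrC.
Qed.

Lemma orth_sum_sub M N1 N2 : is_subspace N1 -> is_subspace N2 ->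
  orth_sum tau M N1 N2 -> N1 `<=` M /\ N2 `<=` M.
Proof.
move=> sN1 sN2 [_ ->]; split=> f Nf.
  by exists f, 0; rewrite addr0; split=> //; exact: sN2.1.
by exists 0, f; rewrite add0r; split=> //; exact: sN1.1.
Qed.

Lemma orth_sum_compl M N1 N2 f : is_subspace N1 -> is_subspace N2 ->
    M `<=` H -> orth_sum tau M N1 N2 ->
  M f -> (forall g, N2 g -> ip f g = 0) -> N1 f.
Proof.
move=> sN1 sN2 MH MN Mf fN2; have [N1M N2M] := orth_sum_sub sN1 sN2 MN.
have [N12 ME] := MN; move: (Mf); rewrite ME => -[g [h [N1g N2h fE]]].
have [Hf Hg Hh] := And3 (MH _ Mf) (MH _ (N1M _ N1g)) (MH _ (N2M _ N2h)).
suff h0 : h = 0 by rewrite fE h0 addr0.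
apply: (ip_eq0 ipP Hh).
have hE : h = f - g by rewrite fE addrC addKr.
by rewrite {1}hE (ipB ipP)// fN2// N12// subrr.
Qed.

End Projections.

(** * The split-shift condition *)

Section SplitShift.
Variables (R : realType) (n m : nat) (tau : {fraction {mpoly R[i][2]}} -> R[i]).
Hypotheses (tau_lin : linear_form n m tau) (tau_pos : positive_form n m tau).

Local Notation poly2 := {mpoly R[i][2]}.
Local Notation H := (@P_ R n m).
Local Notation ip := (inner tau).
Local Notation E := (E1 tau n m).
Local Notation D := (domE1 n m tau).
Local Notation T := (opT n m tau).
Local Notation A := (opA n m tau).
Local Notation B := (opB n m tau).
Local Notation adjA := (adjA n m tau).
Local Notation adjT := (adjT n m tau).
Local Notation wE2 := (wE2 n m tau).
Local Notation wF2 := (wF2 n m tau).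
Local Notation P' := (@P_ R (n%:Z - 1) (m%:Z - 1)).
Implicit Types (f g h : poly2) (M N K : set poly2).

Let sH : is_subspace H. Proof. exact: P_subspace. Qed.

Let sP j k : is_subspace (@P_ R j k). Proof. exact: P_subspace. Qed.

Let finH : exists d (e : 'I_d -> poly2),
  forall f, H f -> exists c : 'rV_d, f = \sum_i c 0 i *: e i.
Proof. exact: P_finite. Qed.

Lemma inner_productP : inner_product H ip.
Proof.
split=> [a f g h Hf Hg Hh|a f g h Hf Hg Hh|f Hf f0]; last exact: tau_pos.
- by rewrite /inner star_mulDl tau_lin//; exact: star_mul_L.
- by rewrite /inner star_mulDr tau_lin//; exact: star_mul_L.
Qed.
Let ipP := inner_productP.

Lemma inner_shift x f g : inverted_monomial x -> ip (x * f) (x * g) = ip f g.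
Proof. by move=> xV; rewrite /inner star_mul_shift. Qed.

Let ipr a f g h : H f -> H g -> H h ->
  ip h (a *: f + g) = a^* * ip h f + ip h g.
Proof. by case: ipP => _ + _; apply. Qed.

Let ipDr f g h : H f -> H g -> H h -> ip h (f + g) = ip h f + ip h g.
Proof.
by move=> Hf Hg Hh; rewrite -[f in LHS]scale1r (ipr 1 Hf Hg Hh) conjC1 mul1r.
Qed.

Local Opaque inner P_.

Lemma P_in j k : j <= n%:Z -> k <= m%:Z -> @P_ R j k `<=` H.
Proof. exact: P_mono. Qed.

Lemma times_w_in j k : j <= n%:Z -> k <= m%:Z - 1 -> times w (@P_ R j k) `<=` H.
Proof.
move=> jn km _ [f Pf <-]; apply: P_mulw.
exact: (P_mono jn km).
Qed.

Let wP'H : times w P' `<=` H. Proof. by apply: times_w_in; lia. Qed.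

Lemma domE1_P : D `<=` P_ (n%:Z - 1) m.
Proof. by move=> f []. Qed.

Lemma domE1_in : D `<=` H.
Proof. by move=> f /domE1_P; apply: P_in => //; lia. Qed.

Lemma domE1_subspace : is_subspace D.
Proof.
apply: (ominus_subspace (H := H) sH ipP).
- exact: P_subspace.
- by apply: P_in; lia.
- exact: wP'H.
Qed.

Lemma wE2_in : wE2 `<=` H.
Proof.
move=> _ [f [Pf _] <-]; apply: (@times_w_in n (m%:Z - 1)) => //.
by exists f.
Qed.

Lemma E2_subspace : is_subspace (E2 tau n (m%:Z - 1)).
Proof.
apply: (ominus_subspace (H := H) sH ipP).
- exact: P_subspace.
- by apply: P_in; lia.
- move=> _ [f Pf <-]; apply: (P_in (j := n) (k := m%:Z - 1)); [lia..|].
  exact: P_mulz.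
Qed.

Lemma wE2_subspace : is_subspace wE2.
Proof. exact: times_subspace E2_subspace. Qed.

Lemma wF2_in : wF2 `<=` H.
Proof.
move=> _ [f [Pf _] <-]; apply: (@times_w_in n (m%:Z - 1)) => //.
by exists f.
Qed.

Let DH f : D f -> H f. Proof. exact: domE1_in. Qed.

Let zDH f : D f -> H (z * f).
Proof. by move=> /domE1_P; exact: P_mulz. Qed.

Lemma opTP f : D f -> D (T f) /\ forall g, D g -> ip (T f) g = ip (z * f) g.
Proof.
move=> Df.
exact: (projP sH ipP finH domE1_subspace domE1_in (zDH Df)).
Qed.

Lemma opAP f : D f -> wE2 (A f) /\ forall g, wE2 g -> ip (A f) g = ip (z * f) g.
Proof.
move=> Df.
exact: (projP sH ipP finH wE2_subspace wE2_in (zDH Df)).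
Qed.

Lemma opBP f : wF2 f -> D (B f) /\ forall g, D g -> ip (B f) g = ip f g.
Proof.
move=> Ff.
exact: (projP sH ipP finH domE1_subspace domE1_in (wF2_in Ff)).
Qed.

Lemma proj_mulz_linear M : is_subspace M -> M `<=` H ->
  linear_on D (fun f => proj tau M (z * f)).
Proof.
move=> sM MH a f g Df Dg; rewrite mulrDr -scalerAr.
exact: (proj_linear sH ipP finH sM MH a (zDH Df) (zDH Dg)).
Qed.

Lemma opT_linear : linear_on D T.
Proof. exact: proj_mulz_linear domE1_subspace domE1_in. Qed.

Lemma opA_linear : linear_on D A.
Proof. exact: proj_mulz_linear wE2_subspace wE2_in. Qed.

Lemma adjTP g : D g ->
  D (adjT g) /\ forall f, D f -> ip (T f) g = ip f (adjT g).
Proof.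
move=> Dg; apply: (adjointP sH ipP finH domE1_subspace domE1_in opT_linear).
  by move=> f /opTP[/DH].
exact: DH.
Qed.

Lemma adjAP g : wE2 g ->
  D (adjA g) /\ forall f, D f -> ip (A f) g = ip f (adjA g).
Proof.
move=> Eg; apply: (adjointP sH ipP finH domE1_subspace domE1_in opA_linear).
  by move=> f /opAP[/wE2_in].
exact: wE2_in.
Qed.

Lemma iter_opT_in f j : D f -> D (iter j T f).
Proof. by move=> Df; elim: j => //= j /opTP[]. Qed.

Lemma iter_adjT_in f j : D f -> D (iter j adjT f).
Proof. by move=> Df; elim: j => //= j /adjTP[]. Qed.

(** A vector f of E^1_{n-1,m} is its own projection there, and the projection
    kills w P_{n-1,m-1}; so the projections of the powers of z generate. *)
Lemma domE1_generators : exists e : 'I_n -> poly2, (forall i, D (e i)) /\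
  forall f, D f -> exists c : 'rV_n, f = \sum_i c 0 i *: e i.
Proof.
have Hz (i : 'I_n) : H (z ^+ i).
  by rewrite -[z ^+ i]mulr1 -(expr0 w); apply: mem_P; have := ltn_ord i; lia.
pose e (i : 'I_n) := proj tau D (z ^+ i).
have eP (i : 'I_n) := projP sH ipP finH domE1_subspace domE1_in (Hz i).
exists e; split=> [i|f Df]; first by case: (eP i).
have [c [g [Pg fE]]] := P_modulo_w (domE1_P Df).
exists c; apply: (ip_inj ipP domE1_subspace domE1_in Df).
  by apply: (subspace_sum _ _ domE1_subspace) => i; case: (eP i).
move=> h Dh; have wg : times w P' (w * g) by exists g.
have Hwg : H (w * g) by exact: wP'H.
rewrite (ip_suml sH ipP (index_enum _) (c 0) (fun i => DH (eP i).1) (DH Dh)).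
have Hs := subspace_sum (index_enum _) (c 0) sH Hz.
rewrite fE -[X in ip (X + _)]scale1r.
rewrite (ip_linear_on ipP (DH Dh) _ Hs Hwg) scale1r.
rewrite (ip_suml sH ipP (index_enum _) (c 0) Hz (DH Dh)).
rewrite (ip_sym_eq0 sH ipP (DH Dh) Hwg (Dh.2 _ wg)) addr0.
by apply: eq_bigr => i _; rewrite (eP i).2.
Qed.

Lemma opA_iter_vanish f : D f ->
    (forall j, (j < n)%N -> A (iter j T f) = 0) ->
  forall j, A (iter j T f) = 0.
Proof.
move=> Df; have [e [De eP]] := domE1_generators.
have DT g : D g -> D (T g) by case/opTP.
exact: (iter_vanish domE1_subspace DT opT_linear opA_linear De eP Df).
Qed.

(** P_{n,m-1} is the orthogonal sum of z P_{n-1,m-1} and E^2_{n,m-1}. Against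
    w z P_{n-1,m-1} the vector z f is orthogonal because multiplication by z is
    isometric; what remains is A f, its component along w E^2_{n,m-1}. *)
Lemma mulz_in_E1 f : D f -> E (z * f) <-> A f = 0.
Proof.
move=> Df; have [EAf AfP] := opAP Df; split=> [[_ zfo]|Af0].
  apply: (ip_eq0 ipP (wE2_in EAf)); rewrite (AfP _ EAf); apply: zfo.
  by case: EAf => g [Pg _] <-; exists g.
split=> [|_ [p Pp <-]]; first exact: zDH.
have zPP : times z P' `<=` P_ n (m%:Z - 1) by move=> _ [q Pq <-]; exact: P_mulz.
have PH : @P_ R n (m%:Z - 1) `<=` H by apply: P_in; lia.
have [_ [r [[q Pq <-] Er ->]]] := ominus_decomposition sH ipP finH
  (sP _ _) PH (times_subspace z (sP _ _)) zPP Pp.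
have wEr : wE2 (w * r) by exists r.
have wq : times w P' (w * q) by exists q.
have Hzwq : H (w * (z * q)) by apply: P_mulw; exact: P_mulz.
rewrite mulrDr (ipDr Hzwq (wE2_in wEr) (zDH Df)) -(AfP _ wEr) Af0.
rewrite (ip0l sH ipP (wE2_in wEr)) addr0 mulrCA.
by rewrite (inner_shift _ _ (inverted_z R)) (Df.2 _ wq).
Qed.

(** P_{n,m-1} is the orthogonal sum of P_{n-1,m-1} and F^2_{n,m-1}, and f is
    orthogonal to w P_{n-1,m-1} already. *)
Lemma in_E1 f : D f -> E f <-> forall g, wF2 g -> ip (B g) f = 0.
Proof.
move=> Df; split=> [[_ fo] g Fg|fB].
  rewrite (opBP Fg).2//; apply: (ip_sym_eq0 sH ipP (DH Df) (wF2_in Fg)).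
  by apply: fo; case: Fg => h [Ph _] <-; exists h.
split=> [|_ [p Pp <-]]; first exact: DH.
have PP : P' `<=` P_ n (m%:Z - 1) by apply: P_mono; lia.
have PH : @P_ R n (m%:Z - 1) `<=` H by apply: P_in; lia.
have [q [r [Pq Fr ->]]] := ominus_decomposition sH ipP finH
  (sP _ _) PH (sP _ _) PP Pp.
have wFr : wF2 (w * r) by exists r.
have wq : times w P' (w * q) by exists q.
have Hwq : H (w * q) by exact: wP'H.
rewrite mulrDr (ipDr Hwq (wF2_in wFr) (DH Df)) (Df.2 _ wq) add0r.
apply: (ip_sym_eq0 sH ipP (wF2_in wFr) (DH Df)).
by rewrite -(opBP wFr).2// fB.
Qed.

(** The core of the argument. Since K1 is the complement of K2 in E^1_{n-1,m},
    each clause of the split-shift condition is one about K2: orthogonality of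
    K1 and z K2 is T-invariance of K2, the inclusion of K1 is that of the range
    of B in K2, and the inclusion of z K2 is that of K2 in the kernel of A. *)
Lemma split_shift_pairP K1 K2 : is_subspace K1 -> is_subspace K2 ->
    orth_sum tau D K1 K2 ->
  split_shift_pair n m tau K1 K2 <->
  [/\ forall f, K2 f -> K2 (T f), forall g, wF2 g -> K2 (B g)
    & forall f, K2 f -> A f = 0].
Proof.
move=> sK1 sK2 KD; have [K12 _] := KD.
have [K1D K2D] := orth_sum_sub sK1 sK2 KD.
have K1H := subset_trans K1D domE1_in; have K2H := subset_trans K2D domE1_in.
have DK := orth_sum_sym sH ipP K1H K2H KD.
have toK2 f : D f -> (forall g, K1 g -> ip f g = 0) -> K2 f.
  exact: (orth_sum_compl ipP sK2 sK1 domE1_in DK).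
split=> [[_ _ [_ K1z K1E K2E]]|[K2T K2B K2A]].
- split=> [f Kf|g Fg|f Kf].
  + have [DT TE] := opTP (K2D _ Kf); apply: toK2 => // g Kg.
    rewrite (TE _ (K1D _ Kg)).
    apply: (ip_sym_eq0 sH ipP (K1H _ Kg) (zDH (K2D _ Kf))).
    by apply: K1z => //; exists f.
  + have [DB BE] := opBP Fg; apply: toK2 => // h Kh.
    exact: ((in_E1 (K1D _ Kh)).1 (K1E _ Kh)).
  + by apply: ((mulz_in_E1 (K2D _ Kf)).1); apply: K2E; exists f.
- split=> //; split=> //.
  + move=> f _ Kf [g Kg <-]; have [DT TE] := opTP (K2D _ Kg).
    apply: (ip_sym_eq0 sH ipP (zDH (K2D _ Kg)) (K1H _ Kf)).
    rewrite -(TE _ (K1D _ Kf)); apply: (ip_sym_eq0 sH ipP (K1H _ Kf) (DH DT)).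
    exact: K12 (K2T _ Kg).
  + move=> f Kf; apply: ((in_E1 (K1D _ Kf)).2) => g Fg.
    have KB := K2B _ Fg.
    exact: (ip_sym_eq0 sH ipP (K1H _ Kf) (K2H _ KB) (K12 _ _ Kf KB)).
  + by move=> _ [f Kf <-]; apply: ((mulz_in_E1 (K2D _ Kf)).2); exact: K2A.
Qed.

Local Notation spaceA := (spaceA n m tau).
Local Notation spaceB := (spaceB n m tau).

Lemma spaceA_generator g j : wE2 g -> spaceA (iter j adjT (adjA g)).
Proof. by move=> Eg; apply: mem_span; exists g, j. Qed.

Lemma spaceB_generator f j : wF2 f -> spaceB (iter j T (B f)).
Proof. by move=> Ff; apply: mem_span; exists f, j. Qed.

Lemma spaceA_domE1 : spaceA `<=` D.
Proof.
apply: smallest_sub; first exact: domE1_subspace.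
by move=> _ [g [j [Eg ->]]]; apply/iter_adjT_in; case: (adjAP Eg).
Qed.

Lemma spaceB_domE1 : spaceB `<=` D.
Proof.
apply: smallest_sub; first exact: domE1_subspace.
by move=> _ [g [j [Fg ->]]]; apply/iter_opT_in; case: (opBP Fg).
Qed.

Lemma inner_adjoint_iter f g j : D f -> wE2 g ->
  ip f (iter j adjT (adjA g)) = ip (A (iter j T f)) g.
Proof.
move=> Df Eg; have [DA AE] := adjAP Eg.
elim: j f Df => [|j IH] f Df; first by rewrite /= AE.
have [DT _] := opTP Df; rewrite [iter _ T f]iterSr -(IH _ DT).
by rewrite ((adjTP (iter_adjT_in j DA)).2 f Df).
Qed.

(** By [inner_adjoint_iter], orthogonality of f to the generators of [spaceA]
    says that every A T^j f is orthogonal to w E^2_{n,m-1}, which contains it.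
    So the complement of [spaceA] is the largest T-invariant subspace on which
    A vanishes. *)
Lemma perp_spaceA f : D f ->
  (forall a, spaceA a -> ip f a = 0) <-> (forall j, A (iter j T f) = 0).
Proof.
move=> Df; split=> [fo j|Af0].
  have [EA _] := opAP (iter_opT_in j Df); apply: (ip_eq0 ipP (wE2_in EA)).
  by rewrite -inner_adjoint_iter// fo//; exact: spaceA_generator.
move=> a aA; have /(_ a aA)[Ha af] : spaceA `<=` [set a | H a /\ ip a f = 0].
  apply: smallest_sub; first exact: (ip_annihilator sH ipP (DH Df)).
  move=> _ [g [j [Eg ->]]]; have [DA _] := adjAP Eg.
  have Da := iter_adjT_in j DA; split; first exact: DH.
  apply: (ip_sym_eq0 sH ipP (DH Df) (DH Da)).
  by rewrite inner_adjoint_iter// Af0 (ip0l sH ipP (wE2_in Eg)).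
exact: (ip_sym_eq0 sH ipP Ha (DH Df)).
Qed.

(** K2 contains the T-orbit of the range of B by [split_shift_pairP]; and A
    vanishes on the T-orbits of K2, which puts K2 in the complement of
    [spaceA], whence the inclusion of [spaceA] in the complement of K2. *)
Lemma split_shift_pair_spaces K1 K2 : split_shift_pair n m tau K1 K2 ->
  spaceA `<=` K1 /\ spaceB `<=` K2.
Proof.
move=> KP; have [[sK1 K1H] [sK2 K2H] [KD _ _ _]] := KP.
have [K2T K2B K2A] := (split_shift_pairP sK1 sK2 KD).1 KP.
have [_ K2D] := orth_sum_sub sK1 sK2 KD.
have K2iter f j : K2 f -> K2 (iter j T f) by move=> Kf; elim: j => //= j /K2T.
split; last first.
  by apply: smallest_sub => // _ [g [j [Fg ->]]]; apply/K2iter/K2B.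
move=> a aA; have Da := spaceA_domE1 aA.
apply: (orth_sum_compl ipP sK1 sK2 domE1_in KD Da) => f Kf.
have Df := K2D _ Kf; apply: (ip_sym_eq0 sH ipP (DH Df) (DH Da)).
by move: a aA {Da}; apply/(perp_spaceA Df) => j; exact/K2A/K2iter.
Qed.

Hypothesis tau_mat : matrix_condition n m tau.

Lemma opA_iter_opB f j : wF2 f -> A (iter j T (B f)) = 0.
Proof.
move=> Ff; apply: opA_iter_vanish; first by case: (opBP Ff).
by move=> k kn; exact: tau_mat.
Qed.

(** [spaceB] is built to be T-invariant and to contain the range of B; the
    matrix condition is what makes A vanish on it. *)
Lemma split_shift_spaceB :
  split_shift_pair n m tau (ominus tau D spaceB) spaceB.
Proof.
have sB : is_subspace spaceB by exact: span_subspace.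
have BH := subset_trans spaceB_domE1 domE1_in.
apply/split_shift_pairP => //.
- exact: (ominus_subspace sH ipP domE1_subspace domE1_in BH).
- exact: (orth_sum_ominus sH ipP finH domE1_subspace domE1_in sB spaceB_domE1).
split=> [|g Fg|].
- suff : spaceB `<=` [set f | D f /\ spaceB (T f)] by move=> BT f /BT[].
  apply: smallest_sub => [|_ [g [j [Fg ->]]]].
    split=> [|a f g [Df BTf] [Dg BTg]].
      rewrite /= (linear_on0 domE1_subspace opT_linear).
      by split; [exact: domE1_subspace.1|exact: sB.1].
    split; first exact: domE1_subspace.2.
    by rewrite (opT_linear a Df Dg); exact: sB.2.
  split; first by apply/iter_opT_in; case: (opBP Fg).
  exact: (spaceB_generator j.+1 Fg).
- exact: (spaceB_generator 0 Fg).
- suff : spaceB `<=` [set f | D f /\ A f = 0] by move=> BA f /BA[].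
  apply: smallest_sub => [|_ [g [j [Fg ->]]]].
    split=> [|a f g [Df Af] [Dg Ag]].
      rewrite /= (linear_on0 domE1_subspace opA_linear).
      by split=> //; exact: domE1_subspace.1.
    split; first exact: domE1_subspace.2.
    by rewrite (opA_linear a Df Dg) Af Ag scaler0 addr0.
  split; first by apply/iter_opT_in; case: (opBP Fg).
  exact: opA_iter_opB.
Qed.

(** The complement of [spaceA] is T-invariant and contained in the kernel of A
    by [perp_spaceA]; the matrix condition makes it contain the range of B. *)
Lemma split_shift_spaceA :
  split_shift_pair n m tau spaceA (ominus tau D spaceA).
Proof.
have sA : is_subspace spaceA by exact: span_subspace.
have AH := subset_trans spaceA_domE1 domE1_in.
have sK2 := ominus_subspace sH ipP domE1_subspace domE1_in AH.
have K2H : ominus tau D spaceA `<=` H by move=> f [/DH].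
apply/split_shift_pairP => //.
  apply: (orth_sum_sym sH ipP K2H AH).
  exact: (orth_sum_ominus sH ipP finH domE1_subspace domE1_in sA spaceA_domE1).
split=> [f [Df /(perp_spaceA Df) fA]|g Fg|f [Df /(perp_spaceA Df) fA]].
- have [DT _] := opTP Df; split=> //; apply/(perp_spaceA DT) => j.
  by rewrite -iterSr fA.
- have [DB _] := opBP Fg; split=> //; apply/(perp_spaceA DB) => j.
  exact: opA_iter_opB.
- exact: fA 0.
Qed.

End SplitShift.

Theorem theorem2p5 (R : realType) (n m : nat)
    (tau : {fraction {mpoly R[i][2]}} -> R[i])
    (tau_lin : linear_form n m tau) (tau_pos : positive_form n m tau)
    (tau_mat : matrix_condition n m tau) :
  [/\ split_shift_pair n m tau
        (ominus tau (E1 tau (n%:Z - 1) m) (spaceB n m tau)) (spaceB n m tau),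
      split_shift_pair n m tau
        (spaceA n m tau) (ominus tau (E1 tau (n%:Z - 1) m) (spaceA n m tau))
    & forall K1' K2' : set {mpoly R[i][2]},
        split_shift_pair n m tau K1' K2' ->
        spaceA n m tau `<=` K1' /\ spaceB n m tau `<=` K2'].
Proof.
split; first exact: split_shift_spaceB.
  exact: split_shift_spaceA.
exact: split_shift_pair_spaces.
Qed.
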